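(* Let $\phi(x)=|1-1/x|$ for all $x>0$. Let $W=\{\phi^n(x_{\mu_\beta}) : \beta\in\Sigma_2,\ n\ge 0\}$, where the sequences $\mu_\beta$ and the points $x_\gamma$ are as defined in the context. Then $W\subset[0,3]$ and $W$ is a bounded uncountable invariant $2$-scrambled set for $\phi$.
   Context: Scrambled sets: for $\delta>0$, a set $S$ is a $\delta$-scrambled set of a map $f$ if for any $x\neq y$ in $S$, $\limsup_{n\to\infty}|f^n(x)-f^n(y)|\ge\delta$ and $\liminf_{n\to\infty}|f^n(x)-f^n(y)|=0$. $S$ is invariant if $f(S)\subset S$. Extension of $\phi$: $\phi$ is extended to a continuous map of the compactification $[0,\infty]$ of $[0,\infty)$ onto itself by $\phi(0)=\infty$, $\phi(\infty)=1$. Sequence spaces: $\Sigma_2$ is the set of all sequences $\beta=\beta_0\beta_1\beta_2\cdots$ with each $\beta_i\in\{0,1\}$, and $\Gamma=\{\gamma_0\gamma_1\gamma_2\cdots\in\Sigma_2 : \text{if }\gamma_j=1\text{ then }\gamma_{j+1}=0\}$. Points $x_\gamma$: put $I_0=[0,1]$, $I_1=[1,\infty]$. The map $\phi$ is strictly decreasing from $I_0$ onto $[0,\infty]$ and strictly increasing from $I_1$ onto $I_0$. For a finite $0$-$1$ word $\gamma_0\gamma_1\cdots\gamma_n$ ($n\ge1$) in which every $1$ that is not the last letter is followed by $0$, define recursively $I_{\gamma_0\gamma_1\cdots\gamma_n}=\{x\in I_{\gamma_0} : \phi(x)\in I_{\gamma_1\cdots\gamma_n}\}$. These are nested compact intervals,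 and for each $\gamma=\gamma_0\gamma_1\gamma_2\cdots\in\Gamma$ the intersection $I_\gamma=\bigcap_{n\ge0}I_{\gamma_0\gamma_1\cdots\gamma_n}$ consists of exactly one point, denoted $x_\gamma$ (so $x_\gamma$ is the unique point of $[0,\infty]$ with $\phi^n(x_\gamma)\in I_{\gamma_n}$ for all $n\ge0$). Sequences $\mu_\beta$: $0^m$ denotes a string of $m$ zeros. For $\beta=\beta_0\beta_1\beta_2\cdots\in\Sigma_2$, define $\mu_\beta=(\mu_\beta)_0(\mu_\beta)_1(\mu_\beta)_2\cdots\in\Gamma$ by $$\mu_\beta=0^{5!}\,A_\beta(5!)\,A_\beta(6!)\,A_\beta(7!)\cdots,$$ where for each $k\ge5$, $A_\beta(k!)=(\mu_\beta)_{k!}(\mu_\beta)_{k!+1}\cdots(\mu_\beta)_{(k+1)!-1}$ is the concatenation of the following $k$ strings, each of length $k!$: $$01\,0^{k!-2},\quad 0\beta_0\,0^{k!-2},\quad 0\beta_1\,0^{k!-2},\quad 0\beta_2\,0^{k!-2},\quad\ldots,\quad 0\beta_{k-2}\,0^{k!-2}.$$ *)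

(* Defs.v *)
From mathcomp Require Import all_boot all_order all_algebra.
From mathcomp Require Import all_classical all_reals all_analysis.

Set Implicit Arguments.
Unset Strict Implicit.
Unset Printing Implicit Defensive.

Import Order.TTheory GRing.Theory Num.Theory.
Import numFieldNormedType.Exports.

Local Open Scope classical_set_scope.
Local Open Scope ring_scope.

(** Chaos for a self-map of the real line.  Limits superior and inferior are
    taken in [\bar R], so that they exist whether or not orbits are bounded. *)

Definition scrambled_set (R : realType) (delta : R) (f : R -> R) (S : set R) :=
  forall x y : R, S x -> S y -> x <> y ->
    (delta%:E <= limn_esup (fun n => (`|iter n f x - iter n f y|)%:E))%E /\
    limn_einf (fun n => (`|iter n f x - iter n f y|)%:E) = 0%E.

Definition invariant_set (R : realType) (f : R -> R) (S : set R) :=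
  f @` S `<=` S.

(** The map |1 - 1/x|.  It is meant on the half-line x > 0 only; the values
    that the totalized inverse gives at x <= 0 are irrelevant. *)
Definition phi (R : realType) (x : R) : R := `|1 - x^-1|.

(** Its extension to [[0, +oo]], with 0 |-> +oo and +oo |-> 1.  The value at
    -oo, and at negative reals, is irrelevant: all the points considered below
    lie in [[0, +oo]]. *)
Definition phi_ext (R : realType) (x : \bar R) : \bar R :=
  match x with
  | r%:E => if r == 0 then +oo%E else (phi r)%:E
  | +oo%E => 1%E
  | -oo%E => 0%E
  end.

(** The digits 0 and 1 are the booleans [false] and [true]; the space of all
    0-1 sequences is [nat -> bool]. *)

Definition Gamma : set (nat -> bool) :=
  [set g | forall j, g j = true -> g j.+1 = false].

Definition Iletter (R : realType) (a : bool) : set (\bar R) :=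
  if a then `[1%E, +oo%E]%classic else `[0%E, 1%E]%classic.
Arguments Iletter : clear implicits.

(** The empty word is given the whole space, so that [Iword [:: a]] is
    [Iletter a]. *)
Fixpoint Iword (R : realType) (w : seq bool) : set (\bar R) :=
  match w with
  | [::] => setT
  | a :: w' => [set x | Iletter R a x /\ @Iword R w' (phi_ext x)]
  end.
Arguments Iword : clear implicits.

Definition Iseq (R : realType) (g : nat -> bool) : set (\bar R) :=
  \bigcap_(n in [set: nat]) Iword R (mkseq g n.+1).
Arguments Iseq : clear implicits.

(** For [g] in [Gamma] the set [Iseq R g] is a singleton, whose element is the
    point selected here; the default value 0 only matters for other [g]. *)
Definition xpt (R : realType) (g : nat -> bool) : \bar R := xget 0%E (Iseq R g).
Arguments xpt : clear implicits.

Local Open Scope nat_scope.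

Definition chunk (k : nat) (b : bool) : seq bool :=
  [:: false; b] ++ nseq (k`! - 2) false.

(** The [k] chunks carry the letters 1, beta_0, ..., beta_(k-2). *)
Definition mu_block (beta : nat -> bool) (k : nat) : seq bool :=
  flatten [seq chunk k b | b <- true :: mkseq beta k.-1].

(** The finite word 0^(5!) A(5!) A(6!) ... A((K+4)!), of length (K+5)!. *)
Definition mu_prefix (beta : nat -> bool) (K : nat) : seq bool :=
  nseq 5`! false ++ flatten [seq mu_block beta k | k <- iota 5 K].

(** These words extend one another and the [n]-th one has length greater
    than [n], so it determines the digit of index [n]. *)
Definition mu (beta : nat -> bool) (n : nat) : bool :=
  nth false (mu_prefix beta n) n.

Local Close Scope nat_scope.

Definition W (R : realType) : set (\bar R) :=
  [set x | exists (beta : nat -> bool) (n : nat),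
     x = iter n (@phi_ext R) (xpt R (mu beta))].
Arguments W : clear implicits.

(** The finite points of [W], as a set of real numbers. *)
Definition Wreal (R : realType) : set R := [set r | W R r%:E].
Arguments Wreal : clear implicits.

(* Main.v *)
Require Import Defs.
From mathcomp Require Import all_boot all_order all_algebra.
From mathcomp Require Import all_classical all_reals all_analysis.
From mathcomp Require Import ring lra zify.

Import Order.TTheory GRing.Theory Num.Theory.
Import numFieldNormedType.Exports.

Local Open Scope classical_set_scope.
Local Open Scope ring_scope.

(** The reason is symbolic.  On [[0, 1]] and on [[1, +oo]] the map [phi] is
    inverted by [y |-> 1 / (1 + y)] and [y |-> 1 / (1 - y)], so an orbit can be
    read off from its itinerary of digits 0 and 1.  Let [z] be the fixed point of
    [phi] in [[0, 1]], that is [z^2 + z = 1].  Two facts about an orbit [u] with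
    itinerary [g] carry the proof:

    - a run of zeros in [g] from time [n] on forces [u n] to be near [z], since
      the inverse branch of digit 0 contracts distances to [z] by the factor [z]
      at least ([zeros_close]);
    - a 1 at time [n] followed by a run of zeros forces [u n] to be near
      [1 / (1 - z) = 2 + z] ([one_close]).

    Hence two orbits come close whenever both read a long run of zeros, and they
    are at distance nearly [(2 + z) - z = 2] whenever one reads 1000... while the
    other reads 0000...

    In [mu beta] every digit at a position [q * k! + i] with [1 <= q <= k] and
    [i < k!] is 0, unless [i = 1], where the digit is the marker 1 for [q = 1] and
    [beta (q - 2)] for [q > 1] ([mu_chunk]).  For large [k] all these runs are
    longer than any prescribed length, so two shifts of such sequences have long
    common runs of zeros arbitrarily late ([mu_common_zeros]).  If the shifts are
    different, the marker of one of them faces zeros of the other; if the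
    shifts agree but [beta i <> beta' i], the digits at [(i + 2) * k! + 1] do the
    same ([mu_one_vs_zeros]).  This gives the limits superior and inferior, and
    also that [beta |-> x_(mu beta)] is injective, so that Cantor's theorem makes
    the set uncountable.

    The bound by 3 and the positivity of the orbits come from each 1 being
    followed by three zeros: if [x] has itinerary 1000... then
    [phi x <= 2 / 3], that is [x <= 3] ([Iletter1000_le3]); and 0 cannot occur as
    its image is [+oo].  The same gap makes the existence of the points a
    statement about nested bounded real intervals ([in_cylinders_ex]). *)

(** * The digits of mu *)

Section Digits.
Local Open Scope nat_scope.

Lemma fact_ge n : n <= n`!.
Proof. by case: n => // n; rewrite factS leq_pmulr // fact_gt0. Qed.

Lemma fact_ge120 k : 5 <= k -> 120 <= k`!.
Proof. by move=> k5; apply: (leq_fact k5). Qed.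

Lemma size_chunk k b : 5 <= k -> size (chunk k b) = k`!.
Proof. by move=> /fact_ge120 k5; rewrite /= size_nseq; lia. Qed.

Lemma nth_chunk k b i : nth false (chunk k b) i = (i == 1) && b.
Proof. by case: i => [|[|i]] //=; rewrite nth_nseq if_same. Qed.

(** All the chunks have the same length [k!], so quotient and remainder of a
    position by [k!] give the chunk and the place in it. *)
Lemma flatten_chunks k (s : seq bool) : 5 <= k ->
  size (flatten [seq chunk k b | b <- s]) = size s * k`! /\
  forall j i, j < size s -> i < k`! ->
    nth false (flatten [seq chunk k b | b <- s]) (j * k`! + i)
    = (i == 1) && nth false s j.
Proof.
move=> k5; elim: s => [|b s [IHsz IHnth]]; first by [].
have -> : flatten [seq chunk k c | c <- b :: s]
  = chunk k b ++ flatten [seq chunk k c | c <- s] by [].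
rewrite size_cat IHsz size_chunk //; split=> [|[|j] i ltj lti].
- by rewrite /= mulSn.
- by rewrite mul0n add0n nth_cat size_chunk // lti nth_chunk.
- rewrite nth_cat size_chunk // mulSn -addnA ltnNge leq_addr /= addKn.
  exact: IHnth.
Qed.

Lemma size_mu_block beta k : 5 <= k -> size (mu_block beta k) = k * k`!.
Proof.
move=> k5; rewrite /mu_block (proj1 (flatten_chunks _ _ k5)) /= size_mkseq.
by rewrite prednK //; lia.
Qed.

Lemma mu_prefixS beta K :
  mu_prefix beta K.+1 = mu_prefix beta K ++ mu_block beta (K + 5).
Proof.
rewrite /mu_prefix -(addn1 K) iotaD map_cat flatten_cat catA (addnC 5).
by congr (_ ++ _); apply: cats0.
Qed.

Lemma size_mu_prefix beta K : size (mu_prefix beta K) = (K + 5)`!.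
Proof.
elim: K => [|K IH]; first by rewrite size_cat size_nseq addn0.
by rewrite mu_prefixS size_cat IH size_mu_block ?leq_addl //.
Qed.

Lemma mu_prefixD beta K d n : n < (K + 5)`! ->
  nth false (mu_prefix beta (K + d)) n = nth false (mu_prefix beta K) n.
Proof.
move=> ltn; elim: d => [|d IH]; first by rewrite addn0.
rewrite addnS mu_prefixS nth_cat size_mu_prefix IH ifT //.
by apply: leq_trans ltn _; apply: leq_fact; lia.
Qed.

(** The prefix used to define the digit of index [n] may be traded for any other
    one that is long enough, since the prefixes extend one another. *)
Lemma muE beta K n : n < (K + 5)`! -> mu beta n = nth false (mu_prefix beta K) n.
Proof.
move=> ltK; rewrite /mu; have ltn : n < (n + 5)`!.
  by apply: leq_trans (fact_ge _); lia.
case: (leqP n K) => [le | /ltnW le].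
  by rewrite -(subnKC le) mu_prefixD.
by rewrite -{1}(subnKC le) mu_prefixD.
Qed.

(** The only digit of the [q]-th chunk that can be nonzero, chunks being counted
    from [q = 1] because the [q]-th one starts at position [q * k!]; the first
    one carries the marker 1. *)
Definition chunk_digit (beta : nat -> bool) (q : nat) : bool :=
  (q == 1) || beta (q - 2).

Lemma mu_head beta n : n < 120 -> mu beta n = false.
Proof.
by move=> ltn; rewrite (muE _ 0) // /mu_prefix cats0 nth_nseq if_same.
Qed.

Lemma mu_chunk beta k q i : 5 <= k -> 0 < q <= k -> i < k`! ->
  mu beta (q * k`! + i) = (i == 1) && chunk_digit beta q.
Proof.
move=> k5 /andP[q0 qk] lti.
have Ek : k = (k - 5) + 5 by rewrite subnK.
rewrite (muE _ (k - 5).+1); last first.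
  rewrite addSn -Ek factS.
  have : q.+1 * k`! <= k.+1 * k`! by rewrite leq_mul2r ltnS qk orbT.
  by rewrite !mulSn; lia.
rewrite mu_prefixS nth_cat size_mu_prefix -Ek ifF; last first.
  apply/negbTE; rewrite -leqNgt; apply: leq_trans (leq_addr _ _).
  by rewrite -{1}[k`!]mul1n leq_mul2r q0 orbT.
case: q q0 qk => // q _ qk; rewrite mulSn -addnA addKn.
rewrite (proj2 (flatten_chunks _ _ k5)) //=; last by rewrite size_mkseq; lia.
congr (_ && _); case: q qk => //= q qk.
by rewrite nth_mkseq /chunk_digit /= ?subSS ?subn0 //; lia.
Qed.

(** Together with [mu_head], [mu_chunk] thus describes every digit. *)
Lemma mu_decomp n : 120 <= n ->
  exists k q i, [/\ 5 <= k, 0 < q <= k, i < k`! & n = q * k`! + i].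
Proof.
move=> n120.
have [k [k5 lek gtk]] : exists k, [/\ 5 <= k, k`! <= n & n < k.+1`!].
  have ex : exists k, n < k.+1`!.
    by exists n; apply: leq_trans (fact_ge _).
  case: (ex_minnP ex) => k ltk mink; exists k; split=> //.
    rewrite leqNgt; apply/negP => k5.
    suff : n < 120 by lia.
    by apply: leq_trans ltk (leq_fact k5).
  case: k ltk mink => [|k] ltk mink; first by rewrite fact0; lia.
  by rewrite leqNgt; apply/negP => /mink; rewrite ltnn.
exists k, (n %/ k`!), (n %% k`!); split => //.
- rewrite divn_gt0 ?fact_gt0 // lek /= -ltnS ltn_divLR ?fact_gt0 //.
- by rewrite ltn_mod fact_gt0.
- exact: divn_eq.
Qed.

(** Three zeros after each 1 is what keeps the orbits in [[0, 3]]; membership in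
    [Gamma] asks for one zero only. *)
Definition sparse (g : nat -> bool) : Prop :=
  forall n i, g n -> 0 < i <= 3 -> g (n + i) = false.

Lemma mu_sparse beta : sparse (mu beta).
Proof.
move=> n j; case: (ltnP n 120) => [/(mu_head beta) -> //|].
move=> /mu_decomp[k [q [i [k5 qk ik ->]]]].
rewrite mu_chunk // => /andP[/eqP -> _] j3.
have := fact_ge120 _ k5 => k120.
by rewrite -addnA mu_chunk //; [case: j j3 | lia].
Qed.

Definition zeros (g : nat -> bool) n L := forall i, i < L -> g (n + i) = false.

(** The run of zeros of a chunk starts two places after its beginning. *)
Lemma mu_zeros beta k q n L : 5 <= k -> 0 < q <= k ->
  q * k`! + 2 <= n -> n + L <= q * k`! + k`! -> zeros (mu beta) n L.
Proof.
move=> k5 qk le1 le2 i iL.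
have -> : n + i = q * k`! + (n + i - q * k`! - 2).+2 by lia.
by rewrite mu_chunk //; lia.
Qed.

(** The first chunk of a late block has a run of zeros much longer than the
    offsets [m] and [n]. *)
Lemma mu_common_zeros beta beta' m n L T :
  exists t, [/\ T <= t, zeros (mu beta) (m + t) L & zeros (mu beta') (n + t) L].
Proof.
pose k := 5 + m + n + L + T.
have k5 : 5 <= k by rewrite /k; lia.
have k1 : 0 < 1 <= k by lia.
have : 5 + m + n + L + T <= k`! := fact_ge k.
exists (k`! + 2); split; first by lia.
- by apply: (mu_zeros _ k 1) => //; lia.
- by apply: (mu_zeros _ k 1) => //; lia.
Qed.

(** The combinatorial source of distances near 2: an orbit reading 1000... is near
    [2 + z] while one reading 0000... is near [z]. *)
Definition one_vs_zeros (g : nat -> bool) m (g' : nat -> bool) n :=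
  forall L T, exists t, [/\ T <= t, g (m + t), zeros g (m + t).+1 L &
    zeros g' (n + t) L].

(** The marker of a late block is met first by the sequence that is shifted less,
    at a time when the other one, being ahead, is already in the run of zeros. *)
Lemma mu_one_vs_zeros_shift beta beta' m n : m < n ->
  one_vs_zeros (mu beta) m (mu beta') n.
Proof.
move=> mn L T; pose k := 5 + m + n + L + T.
have k5 : 5 <= k by rewrite /k; lia.
have k1 : 0 < 1 <= k by lia.
have k120 := fact_ge120 _ k5.
have kf : 5 + m + n + L + T <= k`! := fact_ge k.
exists (k`! + 1 - m).
have E : m + (k`! + 1 - m) = 1 * k`! + 1 by lia.
rewrite E mu_chunk //; last by lia.
split => //; try lia.
- by apply: (mu_zeros _ k 1) => //; lia.
- by apply: (mu_zeros _ k 1) => //; lia.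
Qed.

(** Both sequences are at the letter of chunk [i + 2], which carries digit [i] of
    [beta] and of [beta']. *)
Lemma mu_one_vs_zeros_digit (beta beta' : nat -> bool) m i : beta i -> ~~ beta' i ->
  one_vs_zeros (mu beta) m (mu beta') m.
Proof.
move=> bi bi' L T; pose k := 5 + i + m + L + T.
have k5 : 5 <= k by rewrite /k; lia.
have k1 : 0 < i.+2 <= k by rewrite /k; lia.
have k120 := fact_ge120 _ k5.
have kf : 5 + i + m + L + T <= k`! := fact_ge k.
have kq : k`! <= i.+2 * k`! by rewrite leq_pmull.
exists (i.+2 * k`! + 1 - m).
have E : m + (i.+2 * k`! + 1 - m) = i.+2 * k`! + 1 by lia.
rewrite E mu_chunk //; last by lia.
rewrite /chunk_digit /= subSS subSS subn0 bi; split => //; try lia.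
- by apply: (mu_zeros _ k i.+2) => //; lia.
- case=> [|j] jL.
    rewrite addn0 mu_chunk //; last by lia.
    by rewrite /chunk_digit /= !subSS subn0 (negbTE bi').
  rewrite addnS -addSn.
  by apply: (mu_zeros beta' k i.+2 _ L) => //; lia.
Qed.

Lemma mu_one_vs_zeros beta beta' m n : (beta, m) <> (beta', n) ->
  one_vs_zeros (mu beta) m (mu beta') n \/ one_vs_zeros (mu beta') n (mu beta) m.
Proof.
move=> neq; case: (ltngtP m n) => [mn|mn|mn].
- by left; apply: mu_one_vs_zeros_shift.
- by right; apply: mu_one_vs_zeros_shift.
- subst n; have [i] : exists i, beta i <> beta' i.
    by apply/existsNP => eqb; apply: neq; congr (_, _); apply/funext.
  case bi: (beta i); case bi': (beta' i) => // _.
  + by left; apply: (mu_one_vs_zeros_digit _ _ _ i); rewrite ?bi ?bi'.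
  + by right; apply: (mu_one_vs_zeros_digit _ _ _ i); rewrite ?bi ?bi'.
Qed.

End Digits.

(** * Points with a given itinerary *)

Lemma Iword_iterP (R : realType) (g : nat -> bool) n (x : \bar R) :
  Iword R (mkseq g n) x <->
  forall i, (i < n)%N -> Iletter R (g i) (iter i (@phi_ext R) x).
Proof.
elim: n g x => [|n IH] g x; first by split.
rewrite (_ : mkseq g n.+1 = g 0%N :: mkseq (g \o S) n); last first.
  by rewrite /mkseq /= -[1%N]addn0 iotaDl -map_comp.
split=> [[x0 /IH xS] [|i] ltin // | itin].
  by rewrite iterSr; apply: xS.
split; first exact: (itin 0%N).
by apply/IH => i ltin; rewrite -iterSr; apply: (itin i.+1).
Qed.

Lemma IseqP (R : realType) (g : nat -> bool) (x : \bar R) :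
  Iseq R g x <-> forall n, Iletter R (g n) (iter n (@phi_ext R) x).
Proof.
split=> [xg n | xg n _]; last by apply/Iword_iterP => i _; apply: xg.
by have /Iword_iterP := xg n I; apply.
Qed.

Lemma sparseS {g} : sparse g -> sparse (g \o S).
Proof. by move=> sg n i /= gn i3; rewrite -addSn; apply: sg. Qed.

Lemma phi_le1 {R : realType} {r : R} : 0 < r -> r <= 1 -> phi r = r^-1 - 1.
Proof.
move=> r0 r1; have : 1 <= r^-1 by rewrite invf_ge1.
by rewrite /phi => h; rewrite ler0_norm; lra.
Qed.

Lemma phi_ge1 {R : realType} {r : R} : 1 <= r -> phi r = 1 - r^-1.
Proof.
move=> r1; have : r^-1 <= 1 by rewrite invf_le1 //; lra.
by rewrite /phi => h; rewrite ger0_norm; lra.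
Qed.

Section cylinders.
Context {R : realType}.
Implicit Types (g : nat -> bool) (p q : R * R).

(** A rough interval, depending on the first digits only, for the points whose
    itinerary is the sparse sequence [g].  These four were chosen to be mapped
    into one another by the inverse branches ([pull_base]), with the second end
    kept below 1 where the branch [1 / (1 - y)] is to be applied ([base_lt1]). *)
Definition base g : R * R :=
  if g 0%N then (2, 3) else
  if g 1%N then (4^-1, 1) else
  if g 2%N then (2^-1, 1) else (2^-1, 2 / 3).

(** The image of an interval, given by its ends, under the inverse branch of [phi]
    for the digit [b]; the branch of digit 0 reverses the order. *)
Definition pull (b : bool) p : R * R :=
  if b then ((1 - p.1)^-1, (1 - p.2)^-1) else ((1 + p.2)^-1, (1 + p.1)^-1).

Fixpoint cylinder (n : nat) g : R * R :=
  if n is m.+1 then pull (g 0%N) (cylinder m (g \o S)) else base g.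

Definition subitv p q := [/\ q.1 <= p.1, p.1 <= p.2 & p.2 <= q.2].

Lemma subitv_trans p q r : subitv p q -> subitv q r -> subitv p r.
Proof. by move=> [? ? ?] [? ? ?]; split; lra. Qed.

Lemma pull_subitv (b : bool) p q : 0 <= q.1 -> (b -> q.2 < 1) ->
  subitv p q -> subitv (pull b p) (pull b q).
Proof.
case: p q => [p1 p2] [q1 q2] /= q0 q1b [/= l1 l2 l3].
by case: b q1b => [/(_ isT) q21 | _]; split => /=; rewrite lef_pV2 ?posrE; lra.
Qed.

Lemma base_bounds g : 4^-1 <= (base g).1 /\ (base g).2 <= 3.
Proof.
by rewrite /base; case: (g 0%N) (g 1%N) (g 2%N) => [] [] []; split => /=; lra.
Qed.

Lemma base_lt1 g : sparse g -> g 0%N -> (base (g \o S)).2 < 1.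
Proof.
move=> sg g0; rewrite /base /=.
by rewrite (sg 0%N 1%N g0) // (sg 0%N 2%N g0) // (sg 0%N 3%N g0) //=; lra.
Qed.

(** The first step of the nesting.  The extreme cases are 1000, whose interval is
    exactly the image of the one of 000, and 000, where [1 / (1 + 1 / 2) = 2 / 3]
    closes the system. *)
Lemma pull_base g : sparse g -> subitv (pull (g 0%N) (base (g \o S))) (base g).
Proof.
move=> sg; rewrite /base /pull /=; case g0: (g 0%N).
  rewrite (sg 0%N 1%N g0) // (sg 0%N 2%N g0) // (sg 0%N 3%N g0) //=.
  have -> : (1 - 2^-1 : R)^-1 = 2 by field.
  have -> : (1 - 2 / 3 : R)^-1 = 3 by field.
  by split => /=; lra.
have -> : (2 / 3 : R) = (3 / 2)^-1 by field.
case g1: (g 1%N) => /=.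
  have -> : (1 + 3 : R)^-1 = 4^-1 by field.
  have -> : (1 + 2 : R)^-1 = 3^-1 by field.
  by split => /=; lra.
case g2: (g 2%N) => /=.
  have -> : (1 + 1 : R)^-1 = 2^-1 by field.
  have -> : (1 + 4^-1 : R)^-1 = 4/5 by field.
  by split => /=; lra.
case g3: (g 3%N) => /=.
  have -> : (1 + 1 : R)^-1 = 2^-1 by field.
  have -> : (1 + 2^-1 : R)^-1 = 2/3 by field.
  have -> : (3 / 2 : R)^-1 = 2/3 by field.
  by split => /=; lra.
have -> : (1 + (3/2)^-1 : R)^-1 = 3/5 by field.
have -> : (1 + 2^-1 : R)^-1 = 2/3 by field.
have -> : (3 / 2 : R)^-1 = 2/3 by field.
by split => /=; lra.
Qed.

(** The inverse branches are monotone, so the nesting of the first step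
    propagates. *)
Lemma cylinder_nested n g : sparse g ->
  subitv (cylinder n.+1 g) (cylinder n g) /\ subitv (cylinder n g) (base g).
Proof.
have base_refl h : subitv (base h) (base h).
  by rewrite /base; case: (h 0%N) (h 1%N) (h 2%N) => [] [] []; split => /=; lra.
elim: n g => [|n IH] g sg; first by split; [apply: pull_base|].
have [IH1 IH2] := IH _ (sparseS sg).
have [b1 b2] := base_bounds (g \o S); have [c1 c2 c3] := IH2.
split.
  rewrite -/(cylinder n.+2 g) [cylinder n.+2 g]/(pull _ (cylinder n.+1 _)).
  apply: pull_subitv => //=; first by lra.
  by move=> g0; have := base_lt1 _ sg g0; lra.
apply: subitv_trans (pull_base _ sg); apply: pull_subitv => //; first by lra.
exact: base_lt1.
Qed.

Definition in_cylinders g (x : R) :=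
  forall n, (cylinder n g).1 <= x <= (cylinder n g).2.

(** The supremum of the lower ends works, since each upper end bounds all the lower
    ends. *)
Lemma in_cylinders_ex g : sparse g -> exists x, in_cylinders g x.
Proof.
move=> sg.
have lo_mono m n : (m <= n)%N -> subitv (cylinder n g) (cylinder m g).
  elim: n => [|n IH].
    by rewrite leqn0 => /eqP ->; have [_ ] := cylinder_nested 0 _ sg.
  rewrite leq_eqVlt ltnS => /orP[/eqP -> | /IH].
    have [[a b c] _] := cylinder_nested n.+1 _ sg.
    have [[a' b' c'] _] := cylinder_nested n _ sg.
    by split; lra.
  by apply: subitv_trans; have [] := cylinder_nested n _ sg.
have ub n : ubound (range (fun m => (cylinder m g).1)) (cylinder n g).2.
  move=> _ [m _ <-].
  have [a b c] := lo_mono _ _ (leq_maxl m n).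
  have [a' b' c'] := lo_mono _ _ (leq_maxr m n).
  by lra.
exists (sup (range (fun m => (cylinder m g).1))) => n; apply/andP; split.
  apply: ub_le_sup; last by exists n.
  by exists (cylinder 0 g).2; apply: ub.
by apply: ge_sup; [exists (cylinder 0 g).1, 0%N | apply: ub].
Qed.

(** [phi] undoes the inverse branch that produced the cylinders. *)
Lemma phi_in_cylinders g x : sparse g -> in_cylinders g x ->
  in_cylinders (g \o S) (phi x).
Proof.
move=> sg xg n; have := xg n.+1 => /=.
have [_ [c1 c2 c3]] := cylinder_nested n _ (sparseS sg).
have [b1 _] := base_bounds (g \o S).
move: (cylinder n (g \o S)) c1 c2 c3 => [p1 p2] /= c1 c2 c3.
rewrite /pull; case g0: (g 0%N) => /= /andP[lex gex].
  have b2 := base_lt1 _ sg g0.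
  have i1 : 1 <= (1 - p1)^-1 by rewrite invf_ge1 //; lra.
  rewrite phi_ge1; last by lra.
  have x0 : 0 < x by lra.
  have := lex; rewrite -[x]invrK lef_pV2 ?posrE ?invr_gt0 //; last by lra.
  have := gex; rewrite -[x]invrK lef_pV2 ?posrE ?invr_gt0 //; last by lra.
  by rewrite invrK; lra.
have i1 : (1 + p1)^-1 <= 1 by rewrite invf_le1 //; lra.
have i2 : 0 < (1 + p2)^-1 by rewrite invr_gt0; lra.
have x0 : 0 < x by lra.
rewrite phi_le1 //; last by lra.
have := lex; rewrite -[x]invrK lef_pV2 ?posrE ?invr_gt0 //; last by lra.
have := gex; rewrite -[x]invrK lef_pV2 ?posrE ?invr_gt0 //; last by lra.
by rewrite invrK; lra.
Qed.

Lemma Iseq_nonempty g : sparse g -> Iseq R g !=set0.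
Proof.
move=> sg; have [x xg] := in_cylinders_ex g sg; exists x%:E; apply/IseqP => n.
elim: n g x sg xg => [|n IH] g x sg xg.
  have := xg 0%N; rewrite /= /base /Iletter.
  case: (g 0%N) => /=; first by rewrite in_itv /= leey lee_fin; lra.
  rewrite in_itv /= !lee_fin.
  by case: (g 1%N) => /=; last case: (g 2%N) => /=; lra.
have x0 : 0 < x.
  have /andP[] := xg 0%N; have [] := base_bounds g => /=; lra.
rewrite iterSr /= gt_eqF //.
exact: (IH _ _ (sparseS sg) (phi_in_cylinders _ _ sg xg)).
Qed.

End cylinders.

(** * Orbits and runs of zeros *)

Section dynamics.
Context {R : realType}.
Implicit Types (g : nat -> bool) (u v : nat -> R).

(** Once orbits are known to be real, positive and bounded by 3, the extended
    line can be left behind. *)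
Definition coded_orbit u g := forall n,
  [/\ 0 < u n <= 3, u n.+1 = phi (u n) & if g n then 1 <= u n else u n <= 1].

Lemma Iletter_real (b : bool) (r : R) : Iletter R b r%:E ->
  if b then 1 <= r else 0 <= r <= 1.
Proof. by rewrite /Iletter; case: b; rewrite /= in_itv /= ?leey ?lee_fin ?andbT. Qed.

Lemma Iletter_false (x : \bar R) : Iletter R false x ->
  exists2 r, x = r%:E & 0 <= r <= 1.
Proof.
case: x => [r | | ]; rewrite /= in_itv /=; last 2 first.
- by rewrite leye_eq andbF.
- by [].
by rewrite !lee_fin => r01; exists r.
Qed.

(** Going backwards from the third image: it is at most 1, hence the second one is
    at least 1/2, hence the first one is at most 2/3, hence [x <= 3]. *)
Lemma Iletter1000_le3 (x : \bar R) : Iletter R true x ->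
  (forall i, (0 < i <= 3)%N -> Iletter R false (iter i (@phi_ext R) x)) ->
  exists2 r, x = r%:E & 0 <= r <= 3.
Proof.
case: x => [r | | ] x1 xi.
- have r1 := Iletter_real _ _ x1; exists r => //.
  have r0 : r != 0 by rewrite gt_eqF //; lra.
  have ir : 0 < r^-1 by rewrite invr_gt0; lra.
  have [y] := Iletter_false _ (xi 1%N isT).
  have [w] := Iletter_false _ (xi 2%N isT).
  have [v] := Iletter_false _ (xi 3%N isT).
  rewrite /= (negbTE r0) (phi_ge1 r1) /= => + v01 + w01 + y01.
  move=> + + -[yE]; rewrite yE; case: (y =P 0) => [//|/eqP y0 + [wE]].
  rewrite wE /=; case: (w =P 0) => [//|/eqP w0 [vE]].
  have y_gt0 : 0 < y by rewrite lt0r y0; lra.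
  have iy : 0 < y^-1 by rewrite invr_gt0.
  move: wE; rewrite phi_le1 //; last by lra.
  move=> {}wE.
  have w_gt0 : 0 < w by rewrite lt0r w0; lra.
  move: vE; rewrite phi_le1 //; last by lra.
  move=> {}vE.
  have w2 : 2^-1 <= w.
    by rewrite -[w]invrK lef_pV2 ?posrE ?invr_gt0 //; lra.
  have y23 : y <= 2 / 3.
    rewrite -[y]invrK (_ : 2 / 3 = (3 / 2)^-1); last by field.
    by rewrite lef_pV2 ?posrE ?invr_gt0 //; lra.
  suff : r <= 3 by lra.
  by rewrite -[r]invrK -[3]invrK lef_pV2 ?posrE ?invr_gt0 //; lra.
- have [v] := Iletter_false _ (xi 3%N isT).
  by rewrite /= oner_eq0 /= /phi invr1 subrr normr0 eqxx.
- by have := x1; rewrite /= in_itv.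
Qed.

(** No iterate is 0, because the next one would be infinite while all of them
    are at most 3. *)
Lemma Iseq_coded_orbit g (x : \bar R) : sparse g -> Iseq R g x ->
  exists2 u, forall n, iter n (@phi_ext R) x = (u n)%:E & coded_orbit u g.
Proof.
move=> sg /IseqP xg.
have bnd n : exists2 r, iter n (@phi_ext R) x = r%:E & 0 <= r <= 3.
  case gn: (g n).
    apply: Iletter1000_le3; first by have := xg n; rewrite gn.
    by move=> i i3; rewrite -iterD addnC -(sg n i).
  have [|r -> r01] := Iletter_false (iter n (@phi_ext R) x).
    by have := xg n; rewrite gn.
  by exists r => //; lra.
have [u uE] := choice (fun n => let: ex_intro2 r xr rb := bnd n in
  ex_intro (fun r => iter n (@phi_ext R) x = r%:E /\ 0 <= r <= 3) r (conj xr rb)).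
have u0 n : u n != 0.
  apply/eqP => un0; have [+ _] := uE n.+1; have [xn _] := uE n.
  by rewrite iterS xn un0 /= eqxx.
exists u => n; first by case: (uE n).
have [xn ub] := uE n; split.
- by rewrite lt0r u0.
- have [+ _] := uE n.+1.
  by rewrite iterS xn /= (negbTE (u0 n)) => -[].
- by have := xg n; rewrite xn => /Iletter_real; case: (g n) => // /andP[].
Qed.

Definition golden (z : R) := [/\ 0 < z, z < 1 & z ^+ 2 + z = 1].

Lemma golden_ex : exists z : R, golden z.
Proof.
have s5 : (Num.sqrt 5 : R) ^+ 2 = 5 by rewrite sqr_sqrtr.
have s0 : 0 <= (Num.sqrt 5 : R) by apply: sqrtr_ge0.
exists ((Num.sqrt 5 - 1) / 2); move: (Num.sqrt 5 : R) s5 s0 => s s5 s0.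
have s1 : 1 < s by rewrite -(ltr_pXn2r (_ : 0 < 2)%N) ?nnegrE ?s5 ?expr1n //; lra.
have s3 : s < 3.
  by rewrite -(ltr_pXn2r (_ : 0 < 2)%N) ?nnegrE ?s5 ?expr2 //; lra.
split; [lra | lra |].
have -> : ((s - 1) / 2) ^+ 2 + (s - 1) / 2 = (s ^+ 2 - 1) / 4 by field.
by rewrite s5; field.
Qed.

(** By induction, from [u n - z = (u n * z) * (z - u n.+1)] with [u n <= 1]. *)
Lemma zeros_close z u g n L : golden z -> coded_orbit u g -> zeros g n L.+1 ->
  `|u n - z| <= z ^+ L.
Proof.
move=> [z0 z1 zE] ug; elim: L n => [|L IH] n g0.
  have [un _] := ug n; have := g0 0%N isT; rewrite addn0 => -> /= un1.
  by rewrite expr0 ler_norml; lra.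
have gS : zeros g n.+1 L.+1.
  by move=> i iL; rewrite addSn -addnS; apply: g0; lia.
have [/andP[un _] uS] := ug n; have := g0 0%N isT; rewrite addn0 => -> /= un1.
have un0 : u n != 0 by rewrite gt_eqF.
have -> : u n - z = (u n * z) * (z - u n.+1).
  have uuE : u n * u n.+1 = 1 - u n by rewrite uS phi_le1 // mulrBr divff ?mulr1.
  have -> : u n * z * (z - u n.+1) = u n * z ^+ 2 - z * (u n * u n.+1) by ring.
  rewrite uuE (_ : z ^+ 2 = 1 - z); last by lra.
  by ring.
rewrite normrM distrC exprS ler_pM //; last exact: IH.
by rewrite ger0_norm; nra.
Qed.

(** As [1 / (1 - z) = 2 + z], the distance is that of the images times
    [u n * (2 + z)], a factor below [3 * 3]. *)
Lemma one_close z u g n L : golden z -> coded_orbit u g -> g n -> zeros g n.+1 L.+1 ->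
  `|u n - (2 + z)| <= 9 * z ^+ L.
Proof.
move=> zg ug gn /(zeros_close _ _ _ _ _ zg ug) close; have [z0 z1 zE] := zg.
have [/andP[un un3] uS] := ug n; rewrite gn => un1.
have un0 : u n != 0 by rewrite gt_eqF.
have -> : u n - (2 + z) = (u n * (2 + z)) * (u n.+1 - z).
  have uyE : u n * u n.+1 = u n - 1.
    by rewrite uS phi_ge1 // mulrBr divff // mulr1.
  have -> : u n * (2 + z) * (u n.+1 - z) =
    (2 + z) * (u n * u n.+1) - u n * (2 * z + z ^+ 2) by ring.
  rewrite uyE (_ : z ^+ 2 = 1 - z); last by lra.
  by ring.
by rewrite normrM ler_pM // ger0_norm; nra.
Qed.

Lemma zeros_near z u v g h m n L : golden z -> coded_orbit u g -> coded_orbit v h ->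
  zeros g m L.+1 -> zeros h n L.+1 -> `|u m - v n| <= 2 * z ^+ L.
Proof.
move=> zg ug vh /(zeros_close _ _ _ _ _ zg ug) + /(zeros_close _ _ _ _ _ zg vh).
by rewrite !ler_norml; lra.
Qed.

Lemma one_zeros_far z u v g h m n L : golden z -> coded_orbit u g -> coded_orbit v h ->
  g m -> zeros g m.+1 L.+1 -> zeros h n L.+1 -> 2 - 10 * z ^+ L <= `|u m - v n|.
Proof.
move=> zg ug vh gm /(one_close _ _ _ _ _ zg ug gm) + /(zeros_close _ _ _ _ _ zg vh).
by rewrite ler_normr !ler_norml; lra.
Qed.

Lemma expr_small (z c e : R) : golden z -> 0 < e -> exists L, c * z ^+ L <= e.
Proof.
move=> [z0 z1 _] e0; have /cvgrPdist_le /(_ e e0) [N _ /(_ N (leqnn N))] :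
    (fun L => c * z ^+ L) @ \oo --> c * 0.
  by apply: cvgMl_tmp; apply: cvg_expr; rewrite ger0_norm // ltW.
by rewrite mulr0 sub0r normrN ler_norml => /andP[_ ?]; exists N.
Qed.

Lemma one_vs_zeros_orbits u v g h m n : coded_orbit u g -> coded_orbit v h ->
  one_vs_zeros g m h n ->
  forall (e : R) T, 0 < e -> exists2 t, (T <= t)%N & 2 - e <= `|u (m + t)%N - v (n + t)%N|.
Proof.
move=> ug vh sep e T e0; have [z zg] := golden_ex.
have [L zL] := expr_small _ 10 _ zg e0.
have [t [Tt gt gz hz]] := sep L.+1 T; exists t => //.
by have := one_zeros_far _ _ _ _ _ _ _ _ zg ug vh gt gz hz; lra.
Qed.

End dynamics.

(** * Limits superior and inferior, and Cantor's diagonal *)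

Lemma limn_esup_ge {R : realType} (a : R) (w : nat -> R) :
  (forall (e : R) T, 0 < e -> exists2 t, (T <= t)%N & a - e <= w t) ->
  (a%:E <= limn_esup (fun n => (w n)%:E))%E.
Proof.
move=> far; apply: le_ereal_inf_tmp => _ [V [T _ TV] <-].
apply/lee_addgt0Pr => e e0; have [t Tt wt] := far e T e0.
rewrite -leeBlDr //; apply: (@le_trans _ _ (w t)%:E).
  by rewrite -EFinB lee_fin.
by apply: ereal_sup_ubound; exists t => //; apply: TV.
Qed.

Lemma limn_einf_eq0 {R : realType} (w : nat -> R) : (forall n, 0 <= w n) ->
  (forall (e : R) T, 0 < e -> exists2 t, (T <= t)%N & w t <= e) ->
  limn_einf (fun n => (w n)%:E) = 0%E.
Proof.
move=> w0 small.
rewrite /limn_einf /limf_einf; apply/eqP; rewrite oppe_eq0 eq_le; apply/andP; split.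
  apply: (le_trans (ereal_inf_lbound _)).
    by exists setT => //; apply: filterT.
  by apply: ge_ereal_sup => _ [n _ <-]; rewrite -EFinN lee_fin oppr_le0.
apply: (@limn_esup_ge _ 0 (fun n => - w n)) => e T e0.
by have [t Tt wt] := small e T e0; exists t => //; lra.
Qed.

(** The diagonal [d] differs at [f d] from any preimage of [f d], hence from
    itself. *)
Lemma cantor_noninj (f : (nat -> bool) -> nat) : ~ injective f.
Proof.
move=> finj; pose d n := `[< exists2 b : nat -> bool, f b = n & ~~ b n >].
have dn : d (f d) = ~~ d (f d).
  rewrite {1}/d; case E: (d (f d)) => /=.
    by apply/asboolP => -[b /finj -> ]; rewrite E.
  by apply/asboolP; exists d; rewrite ?E.
by case: (d (f d)) dn.
Qed.

(** * The scrambled set *)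

Lemma mu_orbit {R : realType} beta :
  exists u : nat -> R, (forall n, iter n (@phi_ext R) (xpt R (mu beta)) = (u n)%:E)
    /\ coded_orbit u (mu beta).
Proof.
have xg : Iseq R (mu beta) (xpt R (mu beta)).
  by apply: xgetPex; apply: Iseq_nonempty; apply: mu_sparse.
by have [u uE uc] := Iseq_coded_orbit _ _ (mu_sparse beta) xg; exists u.
Qed.

Theorem theorem1 (R : realType) :
  W R `<=` `[0%E, 3%:E]%classic /\
  [/\ Wreal R `<=` [set x | 0 < x],
      bounded_set (Wreal R),
      ~ countable (Wreal R),
      invariant_set (@phi R) (Wreal R) &
      scrambled_set 2 (@phi R) (Wreal R)].
Proof.
have [U /all_and2[UE Uc]] := choice (@mu_orbit R).
have U03 beta n : 0 < U beta n <= 3 by have [] := Uc beta n.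
have WrealP r : Wreal R r <-> exists beta n, r = U beta n.
  split=> [[beta [n]] | [beta [n ->]]]; last by exists beta, n; rewrite UE.
  by rewrite UE => -[->]; exists beta, n.
have iterU beta n t : iter t (@phi R) (U beta n) = U beta (n + t)%N.
  elim: t => [|t IH]; first by rewrite addn0.
  by rewrite iterS IH addnS; have [_ ->] := Uc beta (n + t)%N.
have far beta m beta' n : (beta, m) <> (beta', n) -> forall (e : R) T, 0 < e ->
    exists2 t, (T <= t)%N & 2 - e <= `|U beta (m + t)%N - U beta' (n + t)%N|.
  case/mu_one_vs_zeros => sep e T e0.
    exact: one_vs_zeros_orbits (Uc _) (Uc _) sep e T e0.
  have [t Tt] := one_vs_zeros_orbits _ _ _ _ _ _ (Uc _) (Uc _) sep e T e0.
  by rewrite distrC; exists t.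
split.
  move=> _ [beta [n ->]]; rewrite UE /= in_itv /= !lee_fin.
  by have := U03 beta n; lra.
split.
- by move=> r /WrealP[beta [n ->]] /=; have /andP[] := U03 beta n.
- exists 3; split=> // M M3 r /WrealP[beta [n ->]] /=.
  by have := U03 beta n; rewrite ler_norml; lra.
- move=> /countable_injP[f finj].
  apply: (cantor_noninj (fun beta => f (U beta 0%N))) => beta beta'.
  move/finj => /(_ _ _)/wrap[||UU].
  + by rewrite inE; apply/WrealP; exists beta, 0%N.
  + by rewrite inE; apply/WrealP; exists beta', 0%N.
  (* equal points would have equal orbits, against a distance of at least 1 *)
  apply: contrapT => neq.
  have [|t _] := far beta 0%N beta' 0%N _ 1 0%N ltr01; first by case.
  by rewrite -!iterU UU subrr normr0; lra.
- move=> _ [r /WrealP[beta [n ->]] <-]; apply/WrealP.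
  by exists beta, n.+1; rewrite -[phi _]/(iter 1 (@phi R) _) iterU addn1.
- move=> x y /WrealP[beta [m ->]] /WrealP[beta' [n ->]] neq.
  rewrite (_ : (fun _ => _) =
      fun t => `|U beta (m + t)%N - U beta' (n + t)%N|%:E); last first.
    by apply/funext => t; rewrite !iterU.
  split; first by apply/limn_esup_ge/far => -[? ?]; subst.
  apply: limn_einf_eq0 => [// | e T e0].
  have [z zg] := @golden_ex R; have [L zL] := expr_small _ 2 _ zg e0.
  have [t [Tt g0 g0']] := mu_common_zeros beta beta' m n L.+1 T.
  exists t => //; apply: le_trans zL.
  exact: zeros_near zg (Uc _) (Uc _) g0 g0'.
Qed.
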